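(* For every $p \geq 1$ there exists a deterministic online algorithm for load balancing of temporary tasks with predicted durations on unrelated machines which is $O\left(\mu\,(p+\log(\mu \tilde{D}))\right)$-competitive for the $\ell_p$-norm objective. In particular, for the $\ell_\infty$-norm objective there exists an $O\left(\mu \log(m\mu\tilde{D})\right)$-competitive online algorithm.
   Context: Load balancing of temporary tasks with predictions: there are $m$ machines. Jobs arrive online at integer time steps $t=0,1,\dots,T-1$ (several jobs may arrive at the same time, in arbitrary order). Job $j$ has an arrival time $t_j$, an actual integer duration $d_j\in\{1,\dots,D\}$, and a load $p_{ij}\in\mathbb{R}_+\cup\{\infty\}$ if assigned to machine $i$; it is alive during time slots $t_j+1,\dots,t_j+d_j$. Upon arrival of job $j$ the algorithm learns $t_j$, the loads $p_{ij}$ and a (possibly inaccurate) real estimate $\tilde d_j\ge 1$ of its duration, but not $d_j$, and must irrevocably assign $j$ to one machine. Let $\tilde D=\max_j \tilde d_j$. Let $\mu_1,\mu_2\ge 1$ be such that for all jobs $d_j\in[\lceil \tilde d_j/\mu_2\rceil,\lfloor \mu_1\tilde d_j\rfloor]$, and let $\mu=\mu_1\mu_2$ (the distortion). The parameters $\mu_1,\mu_2,D,\tilde D$ are not known to the algorithm in advance. The load of machine $i$ at time slot $t$ is $\ell_i(t)=\sum p_{ij}$ over jobs $j$ assigned to $i$ that are alive at $t$, and $\ell(t)=(\ell_1(t),\dots,\ell_m(t))$. The objective is to minimize $\max_t \|\ell(t)\|_p$, where $\|x\|_p=(\sum_i x_i^p)^{1/p}$ and $\|x\|_\infty=\max_i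 x_i$. An online algorithm is $c$-competitive if on every input its objective value is at most $c$ times that of an optimal offline assignment (which knows all jobs and their actual durations); here $c$ may depend on the parameters $\mu,\tilde D,m,p$ of the input.
   Formalization: In the ℓ∞ bound, log(mμD̃) is read as max(1, log(mμD̃)), since for m=μ=D̃=1 the logarithm is 0 and no algorithm is 0-competitive; the online algorithm may observe the durations of jobs that have already departed. *)

(* Defs.v *)
From HB Require Import structures.
From mathcomp Require Import all_boot all_order all_algebra.
From mathcomp Require Import all_classical all_reals all_analysis.

Set Implicit Arguments.
Unset Strict Implicit.
Unset Printing Implicit Defensive.

Import Order.TTheory GRing.Theory Num.Theory.

Local Open Scope ring_scope.

(* The duration estimate is a real number; the load on a machine may be +oo. *)
Record job (R : realType) (m : nat) := Job {
  arrival : nat;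
  duration : nat;
  estimate : R;
  load : 'I_m -> \bar R
}.

(* Jobs are numbered in the order in which they are presented. *)
Record instance (R : realType) (m : nat) := Instance {
  horizon : nat;
  max_duration : nat;
  njobs : nat;
  jobs : 'I_njobs -> job R m
}.

Arguments jobs {R m} i _.

Definition valid_instance (R : realType) (m : nat) (I : instance R m) : Prop :=
  [/\ forall j, (arrival (jobs I j) < horizon I)%N,
      forall j k : 'I_(njobs I),
        (j <= k)%N -> (arrival (jobs I j) <= arrival (jobs I k))%N,
      forall j, (1 <= duration (jobs I j) <= max_duration I)%N,
      forall j, 1 <= estimate (jobs I j)
    & forall j i, (0 <= load (jobs I j) i)%E].

(* mu1 and mu2 bound the under- and over-estimation factors. *)
Definition distortion_bounds (R : realType) (m : nat) (I : instance R m)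
    (mu1 mu2 : R) : Prop :=
  [/\ 1 <= mu1, 1 <= mu2 &
    forall j, let J := jobs I j in
      Num.ceil (estimate J / mu2) <= (duration J)%:Z
        <= Num.floor (mu1 * estimate J)].

(* Estimates are at least 1, so the default value 1 only matters when there
   are no jobs. *)
Definition max_estimate (R : realType) (m : nat) (I : instance R m) : R :=
  \big[Num.max/1]_(j < njobs I) estimate (jobs I j).

Definition alive (R : realType) (m : nat) (J : job R m) (t : nat) : bool :=
  ((arrival J).+1 <= t <= arrival J + duration J)%N.

Definition machine_load (R : realType) (m : nat) (I : instance R m)
    (a : 'I_(njobs I) -> 'I_m) (t : nat) (i : 'I_m) : \bar R :=
  (\sum_(j < njobs I | (a j == i) && alive (jobs I j) t) load (jobs I j) i)%E.

Definition lp_norm (R : realType) (m : nat) (p : R) (x : 'I_m -> \bar R) :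
    \bar R :=
  ((\sum_(i < m) x i `^ p) `^ p^-1)%E.

(* Used for nonnegative vectors only, hence the default value 0. *)
Definition linf_norm (R : realType) (m : nat) (x : 'I_m -> \bar R) : \bar R :=
  (\big[maxe/0]_(i < m) x i)%E.

(* No job is alive outside the time slots 1, ..., horizon + max_duration - 1. *)
Definition objective (R : realType) (m : nat)
    (norm : ('I_m -> \bar R) -> \bar R) (I : instance R m)
    (a : 'I_(njobs I) -> 'I_m) : \bar R :=
  (\big[maxe/0]_(1 <= t < horizon I + max_duration I)
     norm (machine_load a t))%E.

Definition opt (R : realType) (m : nat) (norm : ('I_m -> \bar R) -> \bar R)
    (I : instance R m) : \bar R :=
  (\big[mine/+oo]_(a : {ffun 'I_(njobs I) -> 'I_m}) objective norm a)%E.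

(* What is known about a job at some point in time: the data revealed on its
   arrival and, once the job has departed, its actual duration. *)
Record observation (R : realType) (m : nat) := Observation {
  obs_arrival : nat;
  obs_estimate : R;
  obs_load : 'I_m -> \bar R;
  obs_duration : option nat
}.

Definition observe (R : realType) (m : nat) (now : nat) (J : job R m) :
    observation R m :=
  Observation (arrival J) (estimate J) (@load R m J)
    (if (arrival J + duration J <= now)%N then Some (duration J) else None).

(* A deterministic online algorithm maps the observations of all jobs presented
   so far, the last of which is the job to be assigned, to a machine.  Its own
   earlier decisions are determined by these observations. *)
Definition online_algorithm (R : realType) (m : nat) : Type :=
  seq (observation R m) -> 'I_m.

Definition run (R : realType) (m : nat) (alg : online_algorithm R m)
    (I : instance R m) (j : 'I_(njobs I)) : 'I_m :=
  alg [seq observe (arrival (jobs I j)) (jobs I k)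
      | k : 'I_(njobs I) <- enum 'I_(njobs I) & (k <= j)%N].

(* The ratio c is a function of the distortion and of the largest estimate;
   the algorithm is given neither of them. *)
Definition competitive (R : realType) (m : nat)
    (norm : ('I_m -> \bar R) -> \bar R) (alg : online_algorithm R m)
    (c : R -> R -> R) : Prop :=
  forall (I : instance R m) (mu1 mu2 : R),
    valid_instance I -> distortion_bounds I mu1 mu2 ->
    (objective norm (run alg (I := I))
      <= (c (mu1 * mu2) (max_estimate I))%:E * opt norm I)%E.

(* Main.v *)
(** Every job gets a virtual duration [2 ^ iexp], which is its estimate times a
guess [2 ^ ilevel] of [mu1], rounded up to a power of two; the guess is raised
as soon as some job is seen to outlive it.  Jobs are split into groups by guess
level, by size class of the virtual duration (the logarithms of the class bounds
double), and by arrival block of the length of the class.  In every group a job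
goes to the machine where the increase of [sum_t ||l(t)||_p ^ q] over its virtual
slots is smallest, [q] being about [p] plus the logarithm of the class bound.

When a job arrives, the virtual load of the earlier jobs is nonincreasing in
future time, and the increments of [||.||_p ^ q] are monotone in the load since
[q >= p].  So the increment summed over the virtual slots is at most
[lambda = 2 * 2 ^ ilevel * mu2] times its sum over the slots in which the job is
really alive.  Comparing with the offline assignment [o] this gives
[sum_t ||l||^q <= lambda * sum_t (||l + o||^q - ||l||^q)], hence
[max_t ||l(t)|| <= 8 lambda q * max_t ||o(t)||] as [q] exceeds the logarithm of the
number of slots.  At any time each level and class contribute two blocks, and the
bounds form geometric series in the level and in the class. *)

Require Import Defs.
From HB Require Import structures.
From mathcomp Require Import all_boot all_order all_algebra.
From mathcomp Require Import all_classical all_reals all_analysis.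
From mathcomp Require Import zify ring lra.

Set Implicit Arguments.
Unset Strict Implicit.
Unset Printing Implicit Defensive.

Import Order.TTheory GRing.Theory Num.Theory.

Local Open Scope ring_scope.

(** * Increments of power functions *)

Section PowerIncrements.
Variable R : realType.
Implicit Types (r t u v x y d e : R).

Lemma powR_conv_le r t x y : 1 <= r -> 0 <= t -> t <= 1 -> 0 <= x -> 0 <= y ->
  (t * x + (1 - t) * y) `^ r <= t * x `^ r + (1 - t) * y `^ r.
Proof.
move=> r1 t0 t1 x0 y0.
have := @convex_powR R r r1 (Itv01 t0 t1) x y.
rewrite !inE /= !in_itv /= !andbT => /(_ x0 y0).
by rewrite !convRE.
Qed.

Lemma ler_powR2 r x y : 0 <= r -> 0 <= x -> x <= y -> x `^ r <= y `^ r.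
Proof.
move=> r0 x0 xy; apply: ge0_ler_powR => //; rewrite nnegrE //.
exact: le_trans xy.
Qed.

(** By convexity: with [t = d / (v + d - u)], both [u + d] and [v] are convex combinations of
    [v + d] and [u], with the weights [t] and [1 - t] swapped. Adding the two bounds settles
    [e = d]; monotonicity does the rest. *)
Lemma powR_increment_le r u v d e : 1 <= r -> 0 <= u -> u <= v -> 0 <= d ->
  d <= e -> (u + d) `^ r - u `^ r <= (v + e) `^ r - v `^ r.
Proof.
move=> r1 u0 uv d0 de.
have r0 : 0 <= r by lra.
have step : (v + d) `^ r <= (v + e) `^ r by apply: ler_powR2 => //; lra.
suff: (u + d) `^ r + v `^ r <= u `^ r + (v + d) `^ r by lra.
have [L0|Ln0] := eqVneq (v + d - u) 0.
  have -> : v = u by lra.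
  have -> : d = 0 by lra.
  by rewrite addr0.
have L0 : 0 < v + d - u by rewrite lt_def Ln0 /=; lra.
pose t := d / (v + d - u).
have t0 : 0 <= t by rewrite divr_ge0 // ltW.
have t1 : t <= 1 by rewrite ler_pdivrMr //; lra.
have E1 : u + d = t * (v + d) + (1 - t) * u by rewrite /t; field.
have E2 : v = (1 - t) * (v + d) + (1 - (1 - t)) * u by rewrite /t; field.
have H1 : (u + d) `^ r <= t * (v + d) `^ r + (1 - t) * u `^ r.
  by rewrite {1}E1; apply: powR_conv_le => //; lra.
have H2 : v `^ r <= (1 - t) * (v + d) `^ r + (1 - (1 - t)) * u `^ r.
  by rewrite {1}E2; apply: powR_conv_le => //; lra.
lra.
Qed.

Lemma expr_sub_le (q : nat) (a b : R) : 0 <= a -> a <= b ->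
  b ^+ q - a ^+ q <= q%:R * (b - a) * b ^+ q.-1.
Proof.
move=> a0 ab; have b0 : 0 <= b by lra.
elim: q => [|q IH]; first by rewrite !expr0 subrr !mul0r.
have bq0 : 0 <= b ^+ q by exact: exprn_ge0.
have aq : a ^+ q <= b ^+ q by apply: lerXn2r.
rewrite /= (exprS b) (exprS a) -natr1.
have Eb : q%:R * (b * b ^+ q.-1) = q%:R * b ^+ q :> R.
  by case: q {IH bq0 aq} => [|q]; rewrite ?mul0r // -exprS.
have H : b * (b ^+ q - a ^+ q) <= (b - a) * (q%:R * b ^+ q).
  apply: (le_trans (ler_wpM2l b0 IH)).
  by rewrite -Eb le_eqVlt; apply/orP; left; apply/eqP; ring.
have H2 : (b - a) * a ^+ q <= (b - a) * b ^+ q by apply: ler_wpM2l => //; lra.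
lra.
Qed.

(** With [b = a + V] and [th = 4 * l * q], the mean value bound makes the left side at most
    [th * V * b ^+ q.-1 / 4]. If [th * V <= b], this is at most [b ^+ q / 4], which forces
    [b ^+ q <= 4 / 3 * a ^+ q]; otherwise it is at most [(th * V) ^+ q / 4]. *)
Lemma power_gap_le (q : nat) (l a V : R) : (0 < q)%N -> 1 <= l -> 0 <= a ->
  0 <= V ->
  l * ((a + V) ^+ q - a ^+ q) <= a ^+ q / 2 + (4 * l * q%:R * V) ^+ q.
Proof.
move=> q0 l1 a0 V0.
set th := 4 * l * q%:R; set b := a + V.
have q1 : 1 <= q%:R :> R by rewrite ler1n.
have th0 : 0 < th by rewrite /th !mulr_gt0 //; lra.
have b0 : 0 <= b by rewrite /b; lra.
have aq0 : 0 <= a ^+ q by exact: exprn_ge0.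
have bq0 : 0 <= b ^+ q.-1 by exact: exprn_ge0.
have Ebq : b ^+ q = b * b ^+ q.-1 by rewrite -exprS prednK.
have := @expr_sub_le q a b a0; rewrite {1}/b lerDl => /(_ V0).
have -> : b - a = V by rewrite /b; ring.
move=> H.
have H1 : l * (b ^+ q - a ^+ q) <= (th * V) * b ^+ q.-1 / 4.
  apply: (le_trans (ler_wpM2l _ H)); first by lra.
  by rewrite /th le_eqVlt; apply/orP; left; apply/eqP; field.
have thV0 : 0 <= th * V by rewrite mulr_ge0 // ltW.
have tV0 : 0 <= (th * V) ^+ q by exact: exprn_ge0.
have [thb|bth] := leP (th * V) b.
  have H2 : (th * V) * b ^+ q.-1 <= b ^+ q by rewrite Ebq ler_wpM2r.
  have H3 : b ^+ q <= 4 / 3 * a ^+ q.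
    have : l * (b ^+ q - a ^+ q) <= l * (b ^+ q) / 4.
      have : b ^+ q <= l * b ^+ q by rewrite ler_peMl // exprn_ge0.
      lra.
    rewrite -mulrA ler_pM2l; lra.
  lra.
have H2 : (th * V) * b ^+ q.-1 <= (th * V) ^+ q.
  rewrite -[in leRHS](prednK q0) exprS; apply: ler_wpM2l => //.
  by apply: lerXn2r; rewrite ?nnegrE //; exact: ltW.
lra.
Qed.

(** Terms from [e] on are at most [f e], which is at most the average of the first [e] terms. This
    trades the virtual slots of a job for those in which it is really alive. *)
Lemma sum_nonincreasing_le (f : nat -> R) (d e : nat) (l : R) :
  (forall s, 0 <= f s) -> (forall s s', (s <= s')%N -> f s' <= f s) ->
  (0 < e <= d)%N -> d%:R <= l * e%:R ->
  \sum_(0 <= s < d) f s <= l * \sum_(0 <= s < e) f s.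
Proof.
move=> f0 fni /andP[e0 ed] del.
have eR : 0 < e%:R :> R by rewrite ltr0n.
have H1 : e%:R * f e <= \sum_(0 <= s < e) f s.
  rewrite mulr_natl -[e in f e *+ e]subn0 -sumr_const_nat.
  by apply: ler_sum_nat => s /andP[_ se]; apply: fni; rewrite subn0 ltnW.
have H2 : \sum_(e <= s < d) f s <= (d%:R - e%:R) * f e.
  rewrite -natrB // mulr_natl -sumr_const_nat.
  by apply: ler_sum_nat => s /andP[se _]; apply: fni.
rewrite (big_cat_nat (leq0n e) ed) /=.
set S := \sum_(0 <= s < e) f s in H1 *.
have H3 : (d%:R - e%:R) * f e <= (l - 1) * S.
  have le1 : d%:R - e%:R <= (l - 1) * e%:R by lra.
  have de : (e%:R <= d%:R :> R) by rewrite ler_nat.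
  have l1 : 0 <= l - 1.
    rewrite -(pmulr_lge0 _ eR).
    by apply: le_trans le1; rewrite subr_ge0.
  apply: (@le_trans _ _ ((l - 1) * e%:R * f e)); first exact: ler_wpM2r.
  by rewrite -mulrA ler_wpM2l.
lra.
Qed.

Lemma lerD_telescope (a b x y z : R) : a <= z - y -> b <= y - x ->
  a + b <= z - x.
Proof. lra. Qed.

End PowerIncrements.

(** * The p-norm and the potential *)

HB.lock Definition pnorm (R : realType) (m : nat) (p : R) (x : 'I_m -> R) : R :=
  (\sum_(i < m) x i `^ p) `^ p^-1.

Section FiniteNorm.
Variables (R : realType) (m : nat) (p : R).
Hypothesis p1 : 1 <= p.
Implicit Types (x y z : 'I_m -> R) (i k : 'I_m) (d A B : R).

Local Notation pnorm := (@pnorm R m p).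

Lemma pnormE x : pnorm x = (\sum_(i < m) x i `^ p) `^ p^-1.
Proof. by rewrite pnorm.unlock. Qed.

Definition nonneg x := forall i, 0 <= x i.

Definition add_at x i d : 'I_m -> R := fun k => x k + d *+ (k == i).

Definition pot (q : nat) x : R := pnorm x ^+ q.

Let p0 : 0 < p.
Proof. by rewrite (lt_le_trans ltr01). Qed.

Let pn0 : p != 0.
Proof. by rewrite gt_eqF. Qed.

Let pV0 : 0 <= p^-1.
Proof. by rewrite invr_ge0 ltW. Qed.

Let psum_ge0 x : 0 <= \sum_(i < m) x i `^ p.
Proof. by apply: sumr_ge0 => i _; exact: powR_ge0. Qed.

Lemma pnorm_ge0 x : 0 <= pnorm x.
Proof. by rewrite pnormE powR_ge0. Qed.

Lemma pnorm_powR x : pnorm x `^ p = \sum_(i < m) x i `^ p.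
Proof. by rewrite pnormE -powRrM mulVf // powRr1. Qed.

Lemma pnorm_leP x A : 0 <= A -> pnorm x <= A <-> \sum_(i < m) x i `^ p <= A `^ p.
Proof.
move=> A0; split=> [H|H].
  by rewrite -pnorm_powR; apply: ler_powR2 => //; [exact: ltW|exact: pnorm_ge0].
have -> : A = (A `^ p) `^ p^-1 by rewrite -powRrM mulfV // powRr1.
rewrite pnormE; exact: ler_powR2.
Qed.

Lemma pnorm0 : pnorm (fun=> 0) = 0.
Proof.
by rewrite pnormE big1 ?powR0 ?invr_eq0 // => i _; rewrite powR0.
Qed.

Lemma eq_pnorm x y : x =1 y -> pnorm x = pnorm y.
Proof. by move=> /funext ->. Qed.

Lemma pnorm_eq0 x : nonneg x -> pnorm x = 0 -> x =1 (fun=> 0).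
Proof.
move=> x0 /eqP; rewrite pnormE powR_eq0 => /andP[/eqP S0 _] i.
apply: (@powR_eq0_eq0 _ _ p).
have := psumr_eq0P (fun i (_ : true) => powR_ge0 (x i) p) S0.
exact.
Qed.

Lemma le_pnorm x y : nonneg x -> (forall i, x i <= y i) -> pnorm x <= pnorm y.
Proof.
move=> x0 xy; apply/pnorm_leP; first exact: pnorm_ge0.
rewrite pnorm_powR; apply: ler_sum => i _; apply: ler_powR2 => //.
exact: ltW.
Qed.

(** Minkowski: [x + y] is [A + B] times a convex combination of the normalized vectors [x / A] and
    [y / B], so convexity of the power applies in each coordinate. Vanishing norms are treated
    apart. *)
Lemma ler_pnormD x y : nonneg x -> nonneg y ->
  pnorm (fun i => x i + y i) <= pnorm x + pnorm y.
Proof.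
move=> x0 y0; set A := pnorm x; set B := pnorm y.
have A0 : 0 <= A by exact: pnorm_ge0.
have B0 : 0 <= B by exact: pnorm_ge0.
have [Az|An] := eqVneq A 0.
  have EB : pnorm (fun i => x i + y i) = B.
  apply: eq_pnorm => i.
    have Ex := pnorm_eq0 x0 Az i.
    rewrite Ex.
    exact: add0r.
  rewrite EB.
  exact: (ler_wpDl A0 (lexx B)).
have [Bz|Bn] := eqVneq B 0.
  have EA : pnorm (fun i => x i + y i) = A.
  apply: eq_pnorm => i.
    have Ey := pnorm_eq0 y0 Bz i.
    rewrite Ey.
    exact: addr0.
  rewrite EA.
  exact: (ler_wpDr B0 (lexx A)).
move: (pnorm_powR x) (pnorm_powR y); rewrite -/A -/B => EA EB.
clearbody A B.
have Ap : 0 < A by rewrite lt_def An.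
have Bp : 0 < B by rewrite lt_def Bn.
have AB : 0 < A + B by rewrite addr_gt0.
apply/pnorm_leP; first exact: ltW.
set t := A / (A + B).
have t0 : 0 <= t by rewrite divr_ge0 // ltW.
have t1 : t <= 1 by rewrite ler_pdivrMr // mul1r lerDl.
have H i : (x i + y i) `^ p <=
    (A + B) `^ p * (t / A `^ p * x i `^ p + (1 - t) / B `^ p * y i `^ p).
  have -> : x i + y i = (A + B) * (t * (x i / A) + (1 - t) * (y i / B)).
    by rewrite /t; field; rewrite An Bn gt_eqF.
  have xA : 0 <= x i / A by rewrite divr_ge0.
  have yB : 0 <= y i / B by rewrite divr_ge0.
  rewrite powRM; [|exact: ltW| by rewrite addr_ge0 // mulr_ge0 // subr_ge0].
  apply: ler_wpM2l; first exact: powR_ge0.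
  apply: (le_trans (powR_conv_le _ t0 t1 xA yB)) => //.
  rewrite !powRM ?invr_ge0 //.
  have invE (z : R) : 0 <= z -> z^-1 `^ p = (z `^ p)^-1.
    by move=> z0; rewrite -powR_inv1 // -powRrM mulN1r powRN.
  rewrite !invE //.
  by rewrite le_eqVlt; apply/orP; left; apply/eqP; ring.
apply: (le_trans (ler_sum _ (fun i _ => H i))).
rewrite -mulr_sumr ger_pMr ?powR_gt0 //.
rewrite big_split /= -!mulr_sumr -EA -EB.
rewrite !divfK ?gt_eqF ?powR_gt0 //; lra.
Qed.

Lemma ler_pnorm_sum (I : Type) (s : seq I) (x : I -> 'I_m -> R) :
  (forall j, nonneg (x j)) ->
  pnorm (fun i => \sum_(j <- s) x j i) <= \sum_(j <- s) pnorm (x j).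
Proof.
move=> x0; elim: s => [|j s IH].
  have E : pnorm (fun i => \sum_(j <- [::]) x j i) = 0.
    by rewrite -[RHS]pnorm0; apply: eq_pnorm => i; exact: big_nil.
  by rewrite E big_nil.
rewrite big_cons.
have -> : pnorm (fun i => \sum_(k <- j :: s) x k i) =
    pnorm (fun i => x j i + \sum_(k <- s) x k i).
  by apply: eq_pnorm => i; rewrite big_cons.
apply: (le_trans (ler_pnormD _ _)) => //; last by rewrite lerD2l.
by move=> i; apply: sumr_ge0 => k _; exact: x0.
Qed.

Lemma eq_pot q x y : x =1 y -> pot q x = pot q y.
Proof. by move=> xy; rewrite /pot (eq_pnorm xy). Qed.

Lemma pot_powR q x : (0 < q)%N ->
  pot q x = (\sum_(i < m) x i `^ p) `^ (q%:R / p).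
Proof.
move=> q0; rewrite /pot -powR_mulrn ?pnorm_ge0 // pnormE -powRrM.
by rewrite [p^-1 * _]mulrC.
Qed.

Let psum_add_at x i d : \sum_(k < m) add_at x i d k `^ p =
  \sum_(k < m) x k `^ p + ((x i + d) `^ p - x i `^ p).
Proof.
rewrite (bigD1 i) //= [in RHS](bigD1 i) //= {1}/add_at eqxx mulr1n.
rewrite (eq_bigr (fun k => x k `^ p)); first by ring.
by move=> k /negPf ki; rewrite /add_at ki mulr0n addr0.
Qed.

(* The potential is supermodular and convex in each coordinate because the
   exponent [q / p] is at least [1]. *)
Lemma pot_increment_le (q : nat) x y i d : p <= q%:R -> nonneg x ->
  (forall k, x k <= y k) -> 0 <= d ->
  pot q (add_at x i d) - pot q x <= pot q (add_at y i d) - pot q y.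
Proof.
move=> pq x0 xy d0.
have q0 : (0 < q)%N by rewrite -(ltr0n R) (lt_le_trans p0).
rewrite !(pot_powR _ q0) (psum_add_at x i d) (psum_add_at y i d).
(* The increment bound serves twice: here with exponent [q / p] on the sum of the powers, and in the
   last goal with exponent [p] on coordinate [i]. *)
apply: powR_increment_le.
- by rewrite ler_pdivlMr // mul1r.
- exact: psum_ge0.
- apply: ler_sum => k _; apply: ler_powR2 => //; exact: ltW.
- rewrite subr_ge0; apply: ler_powR2 => //; [exact: ltW|by rewrite lerDl].
- exact: powR_increment_le.
Qed.

Lemma pot_increment_ge0 (q : nat) x i d : nonneg x -> 0 <= d ->
  0 <= pot q (add_at x i d) - pot q x.
Proof.
move=> x0 d0; rewrite subr_ge0 /pot; apply: lerXn2r.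
- by rewrite nnegrE pnorm_ge0.
- by rewrite nnegrE pnorm_ge0.
- by apply: (le_pnorm x0) => k; rewrite lerDl mulrn_wge0.
Qed.

(** When the jobs are added one by one, each increment over [x] is at most the one over the load
    grown so far, and the latter telescope. *)
Lemma pot_increments_sum_le (q : nat) x (s : seq nat) (o : nat -> 'I_m)
    (w : nat -> R) : p <= q%:R -> nonneg x -> (forall j, 0 <= w j) ->
  \sum_(j <- s) (pot q (add_at x (o j) (w j)) - pot q x) <=
  pot q (fun i => x i + \sum_(j <- s | o j == i) w j) - pot q x.
Proof.
move=> pq x0 w0; elim: s => [|j s IH].
  rewrite big_nil subr_ge0 le_eqVlt; apply/orP; left; apply/eqP.
  by apply: eq_pot => i; rewrite big_nil addr0.
rewrite big_cons.
pose y i := x i + \sum_(j <- s | o j == i) w j.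
have s0 i : 0 <= \sum_(j <- s | o j == i) w j by apply: sumr_ge0.
have y0 : nonneg y by move=> i; rewrite addr_ge0.
have xy i : x i <= y i by rewrite lerDl.
have := @pot_increment_le q x y (o j) (w j) pq x0 xy (w0 j).
have -> : pot q (add_at y (o j) (w j)) =
    pot q (fun i => x i + \sum_(k <- j :: s | o k == i) w k).
  apply: eq_pot => i; rewrite /add_at /y big_cons eq_sym.
  by case: eqP => _; rewrite ?mulr1n ?mulr0n; ring.
by move=> H; exact: lerD_telescope H IH.
Qed.

End FiniteNorm.

(** * Greedy assignment within a group *)

Section GreedyGroup.
Variables (R : realType) (m : nat) (F : ('I_m -> R) -> R).
Hypothesis F_ext : forall x y, x =1 y -> F x = F y.
Hypothesis F_incr : forall x y i d, nonneg x -> (forall k, x k <= y k) ->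
  0 <= d -> F (add_at x i d) - F x <= F (add_at y i d) - F y.
Hypothesis F_incr_ge0 : forall x i d, nonneg x -> 0 <= d ->
  0 <= F (add_at x i d) - F x.
Hypothesis F_sum : forall x (s : seq nat) (o : nat -> 'I_m) (w : nat -> R),
  nonneg x -> (forall j, 0 <= w j) ->
  \sum_(j <- s) (F (add_at x (o j) (w j)) - F x) <=
  F (fun i => x i + \sum_(j <- s | o j == i) w j) - F x.

Variables (n lo N : nat) (arr len dur : nat -> nat) (w : nat -> 'I_m -> R).
Variables (sel : pred nat) (a o : nat -> 'I_m) (l : R).

Definition in_slots (b e t : nat) := (b < t <= b + e)%N.

Definition vload (j t : nat) : 'I_m -> R := fun i =>
  \sum_(0 <= k < j | [&& sel k, in_slots (arr k) (len k) t & a k == i]) w k i.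

Definition gain (j : nat) (i : 'I_m) (x : 'I_m -> R) : R :=
  F (add_at x i (w j i)) - F x.

Definition gcost (j : nat) (i : 'I_m) : R :=
  \sum_(0 <= s < len j) gain j i (vload j (arr j + s.+1)).

(** Counting a job only while it is both virtually and really alive keeps its slots inside the
    window of the group and this load below the true load of [o]. *)
Definition oload (t : nat) : 'I_m -> R := fun i =>
  \sum_(0 <= k < n | [&& sel k, in_slots (arr k) (minn (len k) (dur k)) t
                       & o k == i]) w k i.

Hypothesis w_ge0 : forall k i, 0 <= w k i.
Hypothesis arr_mono : forall k j, (k <= j)%N -> (j < n)%N -> (arr k <= arr j)%N.
Hypothesis window : forall j, (j < n)%N -> sel j ->
  (lo <= arr j)%N /\ (arr j + len j <= lo + N)%N.
Hypothesis len_gt0 : forall j, (j < n)%N -> sel j -> (0 < minn (len j) (dur j))%N.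
Hypothesis l_ge0 : 0 <= l.
Hypothesis len_le : forall j, (j < n)%N -> sel j ->
  (len j)%:R <= l * (minn (len j) (dur j))%:R.
Hypothesis greedy : forall j, (j < n)%N -> sel j -> gcost j (a j) <= gcost j (o j).

Lemma vload_ge0 j t : nonneg (vload j t).
Proof. by move=> i; apply: sumr_ge0. Qed.

Lemma le_sum_subpred (r : seq nat) (P Q : pred nat) (f : nat -> R) :
  (forall k, 0 <= f k) -> (forall k, k \in r -> P k -> Q k) ->
  \sum_(k <- r | P k) f k <= \sum_(k <- r | Q k) f k.
Proof.
move=> f0 PQ; rewrite [leLHS]big_mkcond [leRHS]big_mkcond /=.
rewrite !big_seq; apply: ler_sum => k kr.
by have := PQ k kr; case: (P k) => [->//|_]; case: ifP.
Qed.

(** All jobs before [j] have arrived by [arr j], so from then on the virtual load can only lose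
    jobs. *)
Lemma vload_anti j t t' i : (j < n)%N -> (arr j < t <= t')%N ->
  vload j t' i <= vload j t i.
Proof.
move=> jn /andP[jt tt']; apply: le_sum_subpred => // k.
rewrite mem_index_iota => /andP[_ kj] /and3P[-> /andP[_ h2] ->]; rewrite andbT /=.
have kaj := arr_mono (ltnW kj) jn.
by rewrite /in_slots (leq_ltn_trans kaj jt) (leq_trans tt' h2).
Qed.

Lemma vload_mono j j' t i : (j <= j')%N -> vload j t i <= vload j' t i.
Proof.
move=> jj'; rewrite /vload [leRHS](big_cat_nat (leq0n j) jj') /= lerDl.
by apply: sumr_ge0.
Qed.

Lemma sum_slots (f : nat -> R) (b e : nat) : (lo <= b)%N -> (b + e <= lo + N)%N ->
  \sum_(0 <= s < N | in_slots b e (lo + s.+1)) f (lo + s.+1)%N =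
  \sum_(0 <= s < e) f (b + s.+1)%N.
Proof.
move=> lob beN; rewrite /in_slots.
rewrite (@big_cat_nat _ _ _ (b - lo)) //=; last by lia.
rewrite (@big_cat_nat _ _ _ (b - lo + e) (b - lo)) //=; [|by lia..].
rewrite big_nat_cond big1 ?add0r; last by move=> s; lia.
rewrite addrC big_nat_cond big1 ?add0r; last by move=> s; lia.
rewrite -[X in \sum_(X <= _ < _ | _) _]add0n big_addn addKn.
rewrite big_nat_cond [RHS]big_nat_cond.
apply: eq_big => s; first by lia.
by move=> _; congr f; lia.
Qed.

Lemma vloadS j t : sel j -> vload j.+1 t =1
  (if in_slots (arr j) (len j) t then add_at (vload j t) (a j) (w j (a j))
   else vload j t).
Proof.
move=> sj i; rewrite /vload big_mkcond big_nat_recr //= -big_mkcond /= sj /=.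
case: in_slots => /=; last by rewrite addr0.
by rewrite /add_at eq_sym; case: eqP => [->|_]; rewrite ?mulr1n ?mulr0n.
Qed.

Lemma vloadS_notsel j t : ~~ sel j -> vload j.+1 t =1 vload j t.
Proof.
move=> sj i; rewrite /vload big_mkcond big_nat_recr //= -big_mkcond /=.
by rewrite (negPf sj) addr0.
Qed.

Definition phi j := \sum_(0 <= s < N) F (vload j (lo + s.+1)).

Lemma phiS j : (j < n)%N -> sel j -> phi j.+1 - phi j = gcost j (a j).
Proof.
move=> jn sj; have [h1 h2] := window jn sj.
rewrite /gcost.
rewrite -(@sum_slots (fun t => gain j (a j) (vload j t)) _ _ h1 h2).
rewrite /phi -sumrB [RHS]big_mkcond; apply: eq_bigr => s _.
rewrite (F_ext (vloadS _ sj)).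
by case: in_slots => //=; rewrite subrr.
Qed.

(** Greedy choice passes to machine [o j]. There the increments are nonincreasing in time by
    [vload_anti], so [sum_nonincreasing_le] shortens the sum at the price of [l]; finally the load
    seen by [j] is replaced by the larger final load. *)
Lemma gcost_le j : (j < n)%N -> sel j -> gcost j (a j) <=
  l * \sum_(0 <= s < N | in_slots (arr j) (minn (len j) (dur j)) (lo + s.+1))
        gain j (o j) (vload n (lo + s.+1)).
Proof.
move=> jn sj; have [h1 h2] := window jn sj.
rewrite (@sum_slots (fun t => gain j (o j) (vload n t))) //; last first.
  by apply: leq_trans h2; rewrite leq_add2l geq_minl.
apply: (le_trans (greedy jn sj)).
apply: (@le_trans _ _ (l * \sum_(0 <= s < minn (len j) (dur j))
    gain j (o j) (vload j (arr j + s.+1)))).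
  apply: (@sum_nonincreasing_le _
    (fun s => gain j (o j) (vload j (arr j + s.+1)))).
  - by move=> s; apply: F_incr_ge0 => //; exact: vload_ge0.
  - move=> s s' ss'; apply: F_incr => //; first exact: vload_ge0.
    by move=> k; apply: vload_anti => //; lia.
  - by rewrite len_gt0 // geq_minl.
  - exact: len_le.
apply: ler_wpM2l => //; apply: ler_sum => s _; apply: F_incr => //.
  exact: vload_ge0.
by move=> k; apply: vload_mono; exact: ltnW.
Qed.

Lemma greedy_group_potential :
  \sum_(0 <= s < N) (F (vload n (lo + s.+1)) - F (fun=> 0)) <=
  l * \sum_(0 <= s < N) (F (fun i => vload n (lo + s.+1) i + oload (lo + s.+1) i)
                         - F (vload n (lo + s.+1))).
Proof.
have E0 : \sum_(0 <= s < N) F (fun=> 0) = phi 0.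
  by apply: eq_bigr => s _; apply: F_ext => i; rewrite /vload big_geq.
rewrite sumrB E0 -/(phi n).
have step j : (j < n)%N -> phi j.+1 - phi j <= if sel j then
  l * \sum_(0 <= s < N | in_slots (arr j) (minn (len j) (dur j)) (lo + s.+1))
        gain j (o j) (vload n (lo + s.+1)) else 0.
  move=> jn; case: (boolP (sel j)) => sj; first by rewrite phiS //; exact: gcost_le.
  rewrite subr_le0 le_eqVlt; apply/orP; left; apply/eqP.
  by apply: eq_bigr => s _; apply: F_ext; exact: vloadS_notsel.
rewrite -(telescope_sumr phi (leq0n n)).
apply: le_trans.
  by apply: ler_sum_nat => j /andP[_ jn]; exact: (step j jn).
rewrite -big_mkcond -mulr_sumr; apply: ler_wpM2l => //.
(* After exchanging the sums, each slot collects the increments of the jobs counted in [oload], and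
   [F_sum] merges them. *)
rewrite (exchange_big_dep_nat predT) //=; apply: ler_sum => s _.
set t := (lo + s.+1)%N.
rewrite -big_filter.
set js := [seq _ <- _ | _].
have := @F_sum (vload n t) js o (fun j => w j (o j)) (@vload_ge0 n t)
  (fun j => w_ge0 j (o j)).
have -> : F (fun i => vload n t i + \sum_(j <- js | o j == i) w j (o j)) =
    F (fun i => vload n t i + oload t i); last by [].
apply: F_ext => i; congr (_ + _).
rewrite /js big_filter_cond /oload.
apply: eq_big => [k|k /andP[_ /eqP ->//]].
by rewrite andbA.
Qed.

End GreedyGroup.

(** * From the potential inequality to the maximum load of one group *)

Section GroupBound.
Variables (R : realType).

(** By [power_gap_le], half of the sum on the left is absorbed. Hence every [a s ^+ q] is at most
    [2 * N] times [(4 * l * q * V) ^+ q], and the factor [2 * N <= 2 ^ q] costs only [2] after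
    taking roots. *)
Lemma potential_max_le (N q : nat) (l V : R) (a : nat -> R) : (0 < q)%N ->
  1 <= l -> 0 <= V -> (forall s, 0 <= a s) -> (N.*2 <= 2 ^ q)%N ->
  \sum_(0 <= s < N) a s ^+ q <=
    l * \sum_(0 <= s < N) ((a s + V) ^+ q - a s ^+ q) ->
  forall s, (s < N)%N -> a s <= 8 * l * q%:R * V.
Proof.
move=> q0 l1 V0 a0 Nq H s sN.
set S := \sum_(0 <= s < N) a s ^+ q in H.
set th := 4 * l * q%:R * V.
have th0 : 0 <= th by rewrite /th !mulr_ge0 //; lra.
have thq0 : 0 <= th ^+ q by exact: exprn_ge0.
have H1 : S <= S / 2 + N%:R * th ^+ q.
  apply: (le_trans H); rewrite mulr_sumr.
  apply: (@le_trans _ _ (\sum_(0 <= s < N) (a s ^+ q / 2 + th ^+ q))).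
    by apply: ler_sum => k _; apply: power_gap_le.
  by rewrite big_split /= -mulr_suml sumr_const_nat subn0 mulr_natl.
have H2 : a s ^+ q <= S.
  rewrite /S (bigD1_seq s) //= ?iota_uniq ?mem_index_iota ?sN //.
  by rewrite lerDl; apply: sumr_ge0 => k _; apply: exprn_ge0.
have H3 : (N.*2)%:R * th ^+ q <= 2 ^+ q * th ^+ q.
  by apply: ler_wpM2r => //; rewrite -natrX ler_nat.
have H4 : a s ^+ q <= (2 * th) ^+ q.
  rewrite exprMn; apply: (le_trans H2); apply: le_trans H3.
  rewrite -muln2 natrM; lra.
have -> : 8 * l * q%:R * V = 2 * th by rewrite /th; ring.
rewrite -(ler_pXn2r q0) ?nnegrE ?a0 //.
by rewrite mulr_ge0.
Qed.

Variables (m : nat) (p : R) (q n lo N : nat) (arr len dur : nat -> nat).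
Variables (w : nat -> 'I_m -> R) (sel : pred nat) (a o : nat -> 'I_m) (l V : R).

Lemma greedy_group_bound : 1 <= p -> p <= q%:R -> (N.*2 <= 2 ^ q)%N ->
  (forall k i, 0 <= w k i) ->
  (forall k j, (k <= j)%N -> (j < n)%N -> (arr k <= arr j)%N) ->
  (forall j, (j < n)%N -> sel j ->
    (lo <= arr j)%N /\ (arr j + len j <= lo + N)%N) ->
  (forall j, (j < n)%N -> sel j -> (0 < minn (len j) (dur j))%N) ->
  1 <= l ->
  (forall j, (j < n)%N -> sel j ->
    (len j)%:R <= l * (minn (len j) (dur j))%:R) ->
  (forall j, (j < n)%N -> sel j ->
    gcost (pot p q) arr len w sel a j (a j) <=
    gcost (pot p q) arr len w sel a j (o j)) ->
  0 <= V -> (forall t, pnorm p (oload n arr len dur w sel o t) <= V) ->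
  forall t, pnorm p (vload arr len w sel a n t) <= 8 * l * q%:R * V.
Proof.
move=> p1 pq Nq w0 arrm win len0 l1 lenl gr V0 oV t.
have q0 : (0 < q)%N by rewrite -(ltr0n R); apply: lt_le_trans pq; lra.
(* Outside the window no job of the group has a virtual slot. *)
have [/andP[lot tN]|tout] := boolP (lo < t <= lo + N)%N; last first.
  have -> : pnorm p (vload arr len w sel a n t) = 0.
    rewrite -[RHS](@pnorm0 R m p p1); apply: eq_pnorm => i.
    rewrite /vload big_nat_cond big1 // => k.
    case/andP=> /andP[_ kn] /and3P[sk /andP[h1 h2] _].
    have [? ?] := win k kn sk; exfalso; move/negP: tout; apply; lia.
  by rewrite !mulr_ge0 //; lra.
have -> : t = (lo + (t - lo).-1.+1)%N by lia.
apply: (@potential_max_le N q l V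
  (fun s => pnorm p (vload arr len w sel a n (lo + s.+1)))) => //; last by lia.
  by move=> s; exact: pnorm_ge0.
have l0 : 0 <= l by lra.
have := @greedy_group_potential R m (pot p q) (@eq_pot _ _ _ _)
  (fun x y i d x0 xy d0 => @pot_increment_le _ _ _ p1 _ x y i d pq x0 xy d0)
  (@pot_increment_ge0 _ _ _ p1 q)
  (fun x s o w x0 w0 => @pot_increments_sum_le _ _ _ p1 q x s o w pq x0 w0)
  n lo N arr len dur w sel a o l w0 arrm win len0 l0 lenl gr.
have pot0 : pot p q (fun _ : 'I_m => 0) = 0.
  by rewrite /pot pnorm0 // expr0n; case: (q) q0.
have E : \sum_(0 <= s < N) (pot p q (vload arr len w sel a n (lo + s.+1)) -
    pot p q (fun _ : 'I_m => 0)) =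
    \sum_(0 <= s < N) pnorm p (vload arr len w sel a n (lo + s.+1)) ^+ q.
  by apply: eq_bigr => s _; rewrite pot0 subr0.
rewrite E => H; apply: (le_trans H); apply: ler_wpM2l => //; apply: ler_sum => s _.
(* The triangle inequality replaces the comparison load by its norm bound [V]. *)
apply: lerB; last exact: lexx.
have v0 : nonneg (vload arr len w sel a n (lo + s.+1)).
  by move=> i; apply: sumr_ge0.
have o0 : nonneg (oload n arr len dur w sel o (lo + s.+1)).
  by move=> i; apply: sumr_ge0.
rewrite /pot; apply: lerXn2r.
- by rewrite nnegrE pnorm_ge0.
- by rewrite nnegrE; apply: addr_ge0 => //; exact: pnorm_ge0.
- apply: (le_trans (ler_pnormD p1 v0 o0)).
  by apply: lerD; [exact: lexx|exact: oV].
Qed.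

End GroupBound.

(** * The algorithm on items *)

Section CeilLog.
Variable R : realType.
Implicit Type x y : R.

(** For nonnegative [x] this is the least [k] with [x <= 2 ^ k]; it is [0] for [x] up to [1]. *)
Definition clog x : nat := up_log 2 `|Num.ceil x|%N.

Let absz_ceil x : 0 <= x -> (`|Num.ceil x|%N%:R : R) = (Num.ceil x)%:~R.
Proof.
move=> x0; have : 0 <= Num.ceil x by rewrite ceil_ge0 //; lra.
by case: (Num.ceil x) => // k _; rewrite absz_nat.
Qed.

Lemma clog_ge x : 0 <= x -> x <= 2 ^+ clog x.
Proof.
move=> x0; apply: (@le_trans _ _ (`|Num.ceil x|%N%:R)).
  by rewrite absz_ceil // ceil_ge.
by rewrite -natrX ler_nat up_logP.
Qed.

Lemma clog_le x : 1 <= x -> 2 ^+ clog x <= 2 * x.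
Proof.
move=> x1; rewrite /clog; have x0 : 0 <= x by lra.
have [le1|gt1] := leqP `|Num.ceil x|%N 1.
  have -> : up_log 2 `|Num.ceil x| = 0%N by apply/eqP; rewrite up_log_eq0 le1 orbT.
  by rewrite expr0; lra.
have u0 : (0 < up_log 2 `|Num.ceil x|)%N by rewrite up_log_gt0 gt1.
rewrite -(prednK u0) exprS ler_pM2l //.
have := @up_log_gtn 2 _ isT gt1.
set k := (2 ^ _)%N => kc.
have : (k%:Z < Num.ceil x)%R.
  have : 0 <= Num.ceil x by rewrite ceil_ge0 //; lra.
  by move: kc; case: (Num.ceil x) => // c; rewrite absz_nat ltz_nat.
rewrite ltNge ceil_le_int -ltNge => /ltW.
by rewrite -pmulrn natrX.
Qed.

Lemma le_clog x y : 0 <= x -> x <= y -> (clog x <= clog y)%N.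
Proof.
move=> x0 xy; apply: leq_up_log; rewrite -(ler_nat R).
rewrite !absz_ceil //; last exact: le_trans xy.
by rewrite ler_int le_ceil.
Qed.

End CeilLog.

(* [ilevel] is the exponent of the current guess of the underestimation factor,
   and [2 ^ iexp] is the virtual duration of the job. *)
Record item (R : realType) (m : nat) := Item {
  iarr : nat;
  ilevel : nat;
  iexp : nat;
  iload : 'I_m -> \bar R
}.

Section Algorithm.
Variables (R : realType) (m : nat) (i0 : 'I_m) (p : R) (P : nat).
Implicit Types (it : nat -> item R m) (a : nat -> 'I_m) (x : item R m).

(* Virtual durations in the class [c] are at most [2 ^ (P * 2 ^ c)], so that the
   exponents [class_exp c] of the potentials grow geometrically. *)
Definition iclass x : nat := up_log 2 (iexp x %/ P).+1.

Definition class_len (c : nat) : nat := 2 ^ (P * 2 ^ c).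

(** A group lives in a window of two class lengths; the [.+2] makes [2 ^ class_exp c] twice the
    number of its slots. *)
Definition class_exp (c : nat) : nat := (P * 2 ^ c).+2.

Definition ikey x : nat * nat * nat :=
  (ilevel x, iclass x, iarr x %/ class_len (iclass x))%N.

(** An infinite load becomes [0] here; [choose_machine] therefore minimizes only over machines of
    finite load, and falls back on [i0] if there are none. *)
Definition iweight x : 'I_m -> R := fun i => fine (iload x i).

Definition finite_on x (i : 'I_m) : bool := (iload x i < +oo)%E.

Definition cost it a (j : nat) (i : 'I_m) : R :=
  gcost (pot p (class_exp (iclass (it j)))) (fun k => iarr (it k))
    (fun k => 2 ^ iexp (it k))%N (fun k => iweight (it k))
    (fun k => ikey (it k) == ikey (it j)) a j i.

Definition choose_machine it a (j : nat) : 'I_m :=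
  if [pick i | finite_on (it j) i] is Some i1
  then [arg min_(i < i1 | finite_on (it j) i) cost it a j i]%O else i0.

Fixpoint assigned it (n : nat) : seq 'I_m :=
  if n is j.+1 then
    rcons (assigned it j) (choose_machine it (nth i0 (assigned it j)) j)
  else [::].

Definition assign it (j : nat) : 'I_m :=
  choose_machine it (nth i0 (assigned it j)) j.

Lemma size_assigned it n : size (assigned it n) = n.
Proof. by elim: n => //= n IH; rewrite size_rcons IH. Qed.

Lemma nth_assigned it n j : (j < n)%N -> nth i0 (assigned it n) j = assign it j.
Proof.
elim: n => // n IH; rewrite ltnS leq_eqVlt => /orP[/eqP ->|jn] /=.
  by rewrite nth_rcons size_assigned ltnn eqxx.
by rewrite nth_rcons size_assigned jn IH.
Qed.

Lemma eq_cost it it' a a' j i :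
  (forall k, (k <= j)%N -> it k = it' k) -> (forall k, (k < j)%N -> a k = a' k) ->
  cost it a j i = cost it' a' j i.
Proof.
move=> eit ea; rewrite /cost /gcost (eit j) //; apply: eq_big_nat => s _.
rewrite /gain (eit j) //.
suff -> : vload (fun k => iarr (it k)) (fun k => 2 ^ iexp (it k))%N
    (fun k => iweight (it k)) (fun k => ikey (it k) == ikey (it' j)) a j
    (iarr (it' j) + s.+1) =
  vload (fun k => iarr (it' k)) (fun k => 2 ^ iexp (it' k))%N
    (fun k => iweight (it' k)) (fun k => ikey (it' k) == ikey (it' j)) a' j
    (iarr (it' j) + s.+1) by [].
apply/funext => i'; rewrite /vload big_nat_cond [RHS]big_nat_cond.
apply: eq_big => [k|k /andP[/andP[_ kj] _]]; last by rewrite eit // ltnW.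
by case: (ltnP k j) => kj; rewrite ?andbF //= eit ?(ltnW kj) // ea.
Qed.

Lemma eq_choose_machine it it' a a' j :
  (forall k, (k <= j)%N -> it k = it' k) -> (forall k, (k < j)%N -> a k = a' k) ->
  choose_machine it a j = choose_machine it' a' j.
Proof.
move=> eit ea; rewrite /choose_machine.
have -> : cost it a j = cost it' a' j by apply/funext => i; exact: eq_cost.
by rewrite (eit j).
Qed.

(** This is the online property: the decision on [j] is determined by the items up to [j], by strong
    induction through the earlier decisions. *)
Lemma eq_assign it it' j : (forall k, (k <= j)%N -> it k = it' k) ->
  assign it j = assign it' j.
Proof.
elim/ltn_ind: j => j IH eit; apply: eq_choose_machine => // k kj.
rewrite !nth_assigned //; apply: IH => // k' k'k; apply: eit.
exact: leq_trans k'k (ltnW kj).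
Qed.

Lemma assignE it j : assign it j = choose_machine it (assign it) j.
Proof. by apply: eq_choose_machine => // k kj; rewrite nth_assigned. Qed.

Lemma assign_finite it j i : finite_on (it j) i -> finite_on (it j) (assign it j).
Proof.
move=> fi; rewrite /assign /choose_machine; case: pickP => [i1 fi1|/(_ i)].
  by case: (arg_minP (cost it (nth i0 (assigned it j)) j) fi1).
by rewrite fi.
Qed.

Lemma assign_greedy it j i : finite_on (it j) i ->
  cost it (assign it) j (assign it j) <= cost it (assign it) j i.
Proof.
move=> fi; rewrite (assignE it j) /choose_machine; case: pickP => [i1 fi1|/(_ i)].
  case: (arg_minP (cost it (assign it) j) fi1) => i2 _ H; exact: H.
by rewrite fi.
Qed.

End Algorithm.

(** * Summing over groups *)

Lemma ler_sum_cover (R : realType) (X : finType) (n : nat) (Q : pred nat)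
    (S : X -> pred nat) (w : nat -> R) : (forall k, 0 <= w k) ->
  (forall k, (k < n)%N -> Q k -> exists x, S x k) ->
  \sum_(0 <= k < n | Q k) w k <= \sum_x \sum_(0 <= k < n | S x k) w k.
Proof.
move=> w0 cov; rewrite (exchange_big_dep predT) //= big_mkcond.
rewrite big_nat [leRHS]big_nat.
apply: ler_sum => k /andP[_ kn]; case: ifP => [Qk|_]; last by apply: sumr_ge0.
have [x Sxk] := cov k kn Qk.
by rewrite (bigD1 x) //= lerDl; apply: sumr_ge0.
Qed.

Section Schedule.
Variables (R : realType) (m : nat) (i0 : 'I_m) (p : R) (P n : nat).
Variables (it : nat -> item R m) (dur : nat -> nat) (o : nat -> 'I_m).
Variables (mu2 V : R) (K C : nat).

Local Notation arr k := (iarr (it k)).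
Local Notation len k := (2 ^ iexp (it k))%N.
Local Notation w k := (iweight (it k)).
Local Notation a := (assign i0 p P it).

Definition true_load (f : nat -> 'I_m) (t : nat) : 'I_m -> R := fun i =>
  \sum_(0 <= k < n | in_slots (arr k) (dur k) t && (f k == i)) w k i.

Hypothesis p1 : 1 <= p.
Hypothesis pP : p <= P%:R.
Hypothesis load_ge0 : forall k i, (0 <= iload (it k) i)%E.
Hypothesis arr_mono : forall k j, (k <= j)%N -> (j < n)%N -> (arr k <= arr j)%N.
Hypothesis dur_gt0 : forall j, (j < n)%N -> (0 < dur j)%N.
Hypothesis mu2_ge1 : 1 <= mu2.
(** The [2] pays for rounding the estimate up to a power of two, and [mu2] for overestimation. *)
Hypothesis len_le : forall j, (j < n)%N ->
  (len j)%:R <= 2 ^+ ilevel (it j) * (2 * mu2) * (dur j)%:R.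
(** A job seen at the arrival of [j] to outlive its virtual duration would have raised the guess, so
    [j] would have a higher level. *)
Hypothesis guess_ok : forall k j, (k <= j)%N -> (j < n)%N ->
  ilevel (it k) = ilevel (it j) -> (arr j < arr k + dur k)%N ->
  (arr j < arr k + len k)%N.
Hypothesis level_le : forall k, (k < n)%N -> (ilevel (it k) <= K)%N.
Hypothesis class_le : forall k, (k < n)%N -> (iclass P (it k) <= C)%N.
Hypothesis o_finite : forall k, (k < n)%N -> finite_on (it k) (o k).
Hypothesis V_ge0 : 0 <= V.
Hypothesis o_load : forall t, pnorm p (true_load o t) <= V.

Let w_ge0 k i : 0 <= w k i.
Proof. exact: fine_ge0. Qed.

Let P_gt0 : (0 < P)%N.
Proof. by rewrite -(ltr0n R) (lt_le_trans ltr01) // (le_trans p1). Qed.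

Lemma len_class_len k : (len k <= class_len P (iclass P (it k)))%N.
Proof.
rewrite leq_exp2l //.
have := @up_logP 2 (iexp (it k) %/ P).+1 isT; rewrite -/(iclass P (it k)).
have := ltn_ceil (iexp (it k)) P_gt0; nia.
Qed.

Lemma group_load_le (key : nat * nat * nat) (t : nat) :
  pnorm p (vload (fun k => arr k) (fun k => len k) (fun k => w k)
             (fun k => ikey P (it k) == key) a n t) <=
  8 * (2 ^+ key.1.1 * (2 * mu2)) * (class_exp P key.1.2)%:R * V.
Proof.
have k1 : 1 <= 2 ^+ key.1.1 :> R by rewrite exprn_ege1 // ler1n.
have l1 : 1 <= 2 ^+ key.1.1 * (2 * mu2) by rewrite mulr_ege1 //; move: mu2_ge1; lra.
(* The window starts with the arrival block and has two class lengths: one for the arrivals, one for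
   the virtual durations. *)
apply: (@greedy_group_bound R m p (class_exp P key.1.2) n
  (key.2 * class_len P key.1.2) (class_len P key.1.2).*2 _ _ dur _ _ _ o) => //.
- apply: (le_trans pP); rewrite ler_nat /class_exp.
  by apply: (@leq_trans (P * 2 ^ key.1.2)); [rewrite leq_pmulr // expn_gt0|lia].
- by rewrite /class_len /class_exp !expnS -!mul2n mulnA.
- move=> j jn /eqP <-; rewrite /ikey /=; have := len_class_len j.
  set L := class_len _ _ => lenL.
  have L0 : (0 < L)%N by rewrite expn_gt0.
  have := leq_divM (arr j) L; have := ltn_ceil (arr j) L0.
  by move=> *; split; lia.
- by move=> j jn _; rewrite leq_min expn_gt0 dur_gt0.
- move=> j jn /eqP kj; rewrite /minn; case: ifP => _.
    by rewrite ler_peMl.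
  by rewrite -kj /= len_le.
- move=> j jn /eqP kj.
  have := @assign_greedy _ _ i0 p P it j (o j) (o_finite jn).
  by rewrite /cost kj -(_ : iclass P (it j) = key.1.2) // -kj.
- move=> t'; apply: le_trans (o_load t'); apply: le_pnorm => //.
    by move=> i; apply: sumr_ge0.
  move=> i; apply: le_sum_subpred => // k _ /and3P[_ /andP[h1 h2] ->].
  rewrite andbT /in_slots h1 (leq_trans h2) // leq_add2l; exact: geq_minr.
Qed.

(** Arrivals at time [t] itself are excluded, since such jobs are first alive in slot [t.+1].
    Without any arrival the value is [0]. *)
Definition last_arrival (t lev : nat) : nat :=
  \max_(k < n | (ilevel (it k) == lev) && (arr k < t)%N) arr k.

(* Jobs of a level that are alive at [t] were all alive right after the last
   arrival of that level, when the guess had not yet been refuted. *)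
Lemma alive_last_arrival k t : (k < n)%N -> in_slots (arr k) (dur k) t ->
  in_slots (arr k) (len k) (last_arrival t (ilevel (it k))).+1.
Proof.
move=> kn /andP[kt tk]; set lev := ilevel (it k).
pose ok := Ordinal kn.
have card0 : (0 < #|[pred j : 'I_n | (ilevel (it j) == lev) && (arr j < t)%N]|)%N.
  by apply/card_gt0P; exists ok; rewrite inE /= eqxx kt.
have [j /andP[/eqP jl jt] jE] := eq_bigmax_cond (fun j : 'I_n => arr j) card0.
have kj : (arr k <= last_arrival t lev)%N.
  by apply: (leq_bigmax_cond ok); rewrite /= eqxx kt.
rewrite /in_slots ltnS kj /=.
move: kj; rewrite /last_arrival jE => kj.
have [le_kj|lt_jk] := leqP k j.
  by apply: guess_ok => //; exact: leq_trans jt tk.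
(* A job [k] numbered after [j] must arrive together with [j], and its virtual duration is at least
   one slot. *)
have := arr_mono (ltnW lt_jk) kn; have : (0 < len k)%N by rewrite expn_gt0.
by move: kj; lia.
Qed.

(** By [alive_last_arrival], a live job virtually covers the slot after the last arrival of its
    level. Its virtual duration is at most the class length, so it lies in the arrival block of that
    last arrival or in the one before. *)
Lemma schedule_load_le t :
  pnorm p (true_load a t) <=
  \sum_(x : 'I_K.+1 * 'I_C.+1 * bool)
    8 * (2 ^+ x.1.1 * (2 * mu2)) * (class_exp P x.1.2)%:R * V.
Proof.
(* The boolean selects the previous block. If there is none, the truncated subtraction repeats block
   [0], which a cover may do. *)
pose key (x : 'I_K.+1 * 'I_C.+1 * bool) : nat * nat * nat :=
  (x.1.1 : nat, x.1.2 : nat,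
   last_arrival t x.1.1 %/ class_len P x.1.2 - x.2)%N.
pose vl (x : 'I_K.+1 * 'I_C.+1 * bool) :=
  vload (fun k => arr k) (fun k => len k) (fun k => w k)
    (fun k => ikey P (it k) == key x) a n (last_arrival t x.1.1).+1.
have vl0 x : nonneg (vl x) by move=> i; apply: sumr_ge0.
apply: (@le_trans _ _ (\sum_x pnorm p (vl x))); last first.
  by apply: ler_sum => x _; exact: (group_load_le (key x)).
apply: le_trans (ler_pnorm_sum p1 _ vl0); apply: le_pnorm => //.
  by move=> i; apply: sumr_ge0.
move=> i; apply: ler_sum_cover => // k kn /andP[alk aki].
have lK : (ilevel (it k) < K.+1)%N by rewrite ltnS level_le.
have cC : (iclass P (it k) < C.+1)%N by rewrite ltnS class_le.
have val := alive_last_arrival kn alk.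
set L := class_len P (iclass P (it k)).
have L0 : (0 < L)%N by rewrite expn_gt0.
pose b := (last_arrival t (ilevel (it k)) %/ L)%N.
exists (Ordinal lK, Ordinal cC, arr k %/ L != b)%N.
rewrite aki andbT /= val andbT /key /= /ikey -/L -/b; apply/eqP; congr (_, _, _).
have b1 : (arr k %/ L <= b)%N by apply: leq_div2r; case/andP: val.
have b2 : (b <= (arr k %/ L).+1)%N.
  have -> : (arr k %/ L).+1 = ((arr k + L) %/ L)%N.
    by rewrite divnDr // divnn L0 addn1.
  apply: leq_div2r; case/andP: val => _ H.
  by apply: ltnW; apply: leq_trans H _; rewrite leq_add2l len_class_len.
move: b1 b2; move: (arr k %/ L)%N b => y b b1 b2.
by case: (y =P b) => [->|/eqP yb] /=; [rewrite subn0|lia].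
Qed.

End Schedule.

(** * Geometric series and the constant of the ratio *)

Section Numerics.
Variable R : realType.

Lemma sum_exp2_le (K : nat) : \sum_(k < K.+1) 2 ^+ k <= 2 * 2 ^+ K :> R.
Proof.
elim: K => [|K IH]; first by rewrite big_ord1 expr0; lra.
by rewrite big_ord_recr /= exprS; lra.
Qed.

Lemma sum_class_exp_le (P C : nat) : (0 < P)%N ->
  \sum_(c < C.+1) (class_exp P c)%:R <= 6 * (P * 2 ^ C)%:R :> R.
Proof.
move=> P0.
apply: (@le_trans _ _ (\sum_(c < C.+1) 3 * P%:R * 2 ^+ c)).
  apply: ler_sum => c _.
  have -> : 3 * P%:R * 2 ^+ c = (3 * P * 2 ^ c)%:R :> R by rewrite !natrM natrX.
  rewrite ler_nat /class_exp.
  have : (0 < P * 2 ^ c)%N by rewrite muln_gt0 P0 expn_gt0.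
  by lia.
rewrite -mulr_sumr natrM natrX.
have -> : 6 * (P%:R * 2 ^+ C) = 3 * P%:R * (2 * 2 ^+ C) :> R by ring.
by apply: ler_wpM2l; [rewrite mulr_ge0|exact: sum_exp2_le].
Qed.

(** The constant is [8 * 2] from the group bound, times [2] for the two blocks, times [2] and [6]
    for the series over levels and classes. *)
Lemma sum_levels_le (P K C : nat) (mu2 V : R) : (0 < P)%N -> 0 <= mu2 -> 0 <= V ->
  \sum_(x : 'I_K.+1 * 'I_C.+1 * bool)
    8 * (2 ^+ x.1.1 * (2 * mu2)) * (class_exp P x.1.2)%:R * V <=
  384 * mu2 * 2 ^+ K * (P * 2 ^ C)%:R * V.
Proof.
move=> P0 mu0 V0.
rewrite -(pair_bigA _ (fun (x : 'I_K.+1 * 'I_C.+1) (e : bool) =>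
  8 * (2 ^+ x.1 * (2 * mu2)) * (class_exp P x.2)%:R * V)) /=.
under eq_bigr do rewrite sumr_const card_bool.
rewrite -(pair_bigA _ (fun (k : 'I_K.+1) (c : 'I_C.+1) =>
  (8 * (2 ^+ k * (2 * mu2)) * (class_exp P c)%:R * V) *+ 2)) /=.
have -> : \sum_(k < K.+1) \sum_(c < C.+1)
    (8 * (2 ^+ k * (2 * mu2)) * (class_exp P c)%:R * V) *+ 2 =
  32 * mu2 * V * ((\sum_(k < K.+1) 2 ^+ k) * (\sum_(c < C.+1) (class_exp P c)%:R)).
  rewrite big_distrl /= mulr_sumr; apply: eq_bigr => k _.
  rewrite big_distrr /= mulr_sumr; apply: eq_bigr => c _; ring.
have -> : 384 * mu2 * 2 ^+ K * (P * 2 ^ C)%:R * V =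
  32 * mu2 * V * ((2 * 2 ^+ K) * (6 * (P * 2 ^ C)%:R)) by ring.
apply: ler_wpM2l; first by rewrite !mulr_ge0.
apply: ler_pM; [| |exact: sum_exp2_le|exact: sum_class_exp_le].
- by apply: sumr_ge0 => k _; exact: exprn_ge0.
- by apply: sumr_ge0.
Qed.

(** In class [0] the size is [P]; in a later class, half the power of two is at most [h %/ P], so
    the size is at most [2 * h]. *)
Lemma class_size_le (P h : nat) : (0 < P)%N ->
  (P * 2 ^ up_log 2 (h %/ P).+1 <= P + 2 * h)%N.
Proof.
move=> P0; have [le1|gt1] := leqP (h %/ P).+1 1.
  have -> : up_log 2 (h %/ P).+1 = 0%N by apply/eqP; rewrite up_log_eq0 le1 orbT.
  by rewrite expn0 muln1 leq_addr.
have u0 : (0 < up_log 2 (h %/ P).+1)%N by rewrite up_log_gt0 gt1.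
rewrite -(prednK u0) expnS.
have := @up_log_gtn 2 _ isT gt1; rewrite ltnS.
move: (2 ^ _)%N => k kh; have := leq_divM h P; nia.
Qed.

Lemma ln2_ge : 1 / 2 <= ln 2 :> R.
Proof.
have : ln (1 + - (1 / 2) : R) <= - (1 / 2) by apply: le_ln1Dx; lra.
have -> : 1 + - (1 / 2) = 2^-1 :> R by field.
by rewrite lnV ?posrE //; lra.
Qed.

Lemma exponent_le (h : nat) (y : R) : 1 <= y -> 2 ^+ h <= 4 * y ->
  h%:R <= 4 + 2 * ln y.
Proof.
move=> y1 hy.
have y0 : 0 < y by lra.
have ly : 0 <= ln y by exact: ln_ge0.
have : ln (2 ^+ h : R) <= ln (4 * y).
  by rewrite ler_ln ?posrE ?exprn_gt0 ?mulr_gt0.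
have l4 : ln 4 = 2 * ln 2 :> R.
  by rewrite (_ : 4 = 2 ^+ 2) ?lnXn ?mulr_natl //; ring.
rewrite lnXn // lnM ?posrE // l4 -[ln 2 *+ h]mulr_natl.
have l2 := ln2_ge; set L := ln 2 in l2 *.
have L0 : 0 < L by lra.
move=> H; rewrite -(ler_pM2r L0); apply: (le_trans H).
have : 0 <= (L - 1/2) * ln y by rewrite mulr_ge0 //; lra.
lra.
Qed.

(** The choice of [20 ^+ 3 = 8000] leaves room for [384 * 2 * 10 = 7680]. *)
Lemma product_le (mu1 mu2 x y z : R) : 0 <= mu1 -> 0 <= mu2 -> 0 <= x ->
  x <= 2 * mu1 -> 0 <= y -> y <= 10 * z ->
  384 * mu2 * x * y <= 20 ^+ 3 * (mu1 * mu2 * z).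
Proof.
move=> m1 m2 x0 xm y0 yz.
have H1 : x * y <= (2 * mu1) * (10 * z) by apply: ler_pM.
have H2 : mu2 * (x * y) <= mu2 * ((2 * mu1) * (10 * z)) by apply: ler_wpM2l.
have z0 : 0 <= z by lra.
have : 0 <= mu1 * mu2 * z by rewrite !mulr_ge0.
lra.
Qed.

Lemma ratio_le (p mu1 mu2 D V : R) : 1 <= p -> 1 <= mu1 -> 1 <= mu2 ->
  1 <= D -> 0 <= V ->
  384 * mu2 * 2 ^+ clog mu1 *
    (2 ^ clog p *
     2 ^ up_log 2 ((clog mu1 + clog D) %/ 2 ^ clog p).+1)%N%:R * V <=
  20 ^+ 3 * (mu1 * mu2 * (p + ln (mu1 * mu2 * D))) * V.
Proof.
move=> p1 m1 m2 D1 V0; apply: ler_wpM2r => //.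
set h := (clog mu1 + clog D)%N; set P := (2 ^ clog p)%N.
have PR : P%:R <= 2 * p by rewrite natrX clog_le.
have P0 : (0 < P)%N by rewrite expn_gt0.
have hD : 2 ^+ h <= 4 * (mu1 * mu2 * D).
  rewrite exprD; apply: (@le_trans _ _ ((2 * mu1) * (2 * D))).
    by apply: ler_pM; rewrite ?exprn_ge0 ?clog_le.
  have : 0 <= (mu2 - 1) * (mu1 * D) by rewrite mulr_ge0 ?mulr_ge0 //; lra.
  lra.
have y1 : 1 <= mu1 * mu2 * D by rewrite !mulr_ege1.
have hl := exponent_le y1 hD.
have ly := ln_ge0 y1.
set l := ln _ in hl ly *.
(* Here [P <= 2 * p] and [2 * h <= 8 + 4 * l], and the [8] is absorbed into [8 * p]. *)
have cl : (P * 2 ^ up_log 2 (h %/ P).+1)%N%:R <= 10 * (p + l).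
  apply: (@le_trans _ _ (P + 2 * h)%N%:R); first by rewrite ler_nat class_size_le.
  rewrite natrD natrM; lra.
have k1 : 2 ^+ clog mu1 <= 2 * mu1 by rewrite clog_le.
have m10 : 0 <= mu1 by exact: le_trans m1.
have m20 : 0 <= mu2 by exact: le_trans m2.
exact: (product_le m10 m20 (exprn_ge0 _ (ler0n _ _)) k1 (ler0n _ _) cl).
Qed.

End Numerics.

(** * Online observations and instances *)

Section OnlineView.
Variables (R : realType) (m : nat).

Definition obs0 : observation R m := Observation 0 1 (fun=> 0%E) None.

(* A lower bound on the duration, known at time [t]: a job that has not departed
   at time [t] is alive in slot [t.+1]. *)
Definition obs_elapsed (x : observation R m) (t : nat) : nat :=
  if obs_duration x is Some d then minn d (t.+1 - obs_arrival x)
  else (t.+1 - obs_arrival x)%N.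

(** The level is the least exponent whose power of two bounds every ratio of elapsed time to
    estimate witnessed up to the arrival of job [j]. *)
Definition obs_item (s : seq (observation R m)) (j : nat) : item R m :=
  let x := nth obs0 s j in
  let lev := \max_(k < j.+1)
    clog ((obs_elapsed (nth obs0 s k) (obs_arrival x))%:R
          / obs_estimate (nth obs0 s k)) in
  Item (obs_arrival x) lev (lev + clog (obs_estimate x)) (obs_load x).

Definition balance (i0 : 'I_m) (p : R) : online_algorithm R m := fun s =>
  assign i0 p (2 ^ clog p) (obs_item s) (size s).-1.

(** The same item written with actual durations, for the analysis; capping them at the elapsed time
    keeps hidden information out. *)
Definition job_item (J : nat -> job R m) (j : nat) : item R m :=
  let lev := \max_(k < j.+1)
    clog ((minn (duration (J k)) ((arrival (J j)).+1 - arrival (J k)))%:R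
          / estimate (J k)) in
  Item (arrival (J j)) lev (lev + clog (estimate (J j))) (load (J j)).

Lemma obs_elapsed_observe (now t : nat) (J : job R m) : (t <= now)%N ->
  obs_elapsed (observe now J) t = minn (duration J) (t.+1 - arrival J).
Proof. by rewrite /obs_elapsed /observe /=; case: ifP => //=; lia. Qed.

Variable I : instance R m.

Definition job0 : job R m := Job 0 1 1 (fun=> 0%E).

Definition nth_job (k : nat) : job R m :=
  if insub k is Some j then jobs I j else job0.

Lemma nth_jobE (j : 'I_(njobs I)) : nth_job j = jobs I j.
Proof. by rewrite /nth_job valK. Qed.

Lemma nth_observe (now : nat) (j : 'I_(njobs I)) (k : nat) : (k <= j)%N ->
  nth obs0 [seq observe now (jobs I k)
           | k : 'I_(njobs I) <- enum 'I_(njobs I) & (k <= j)%N] k =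
  observe now (nth_job k).
Proof.
move=> kj; have -> : [seq observe now (jobs I k)
           | k : 'I_(njobs I) <- enum 'I_(njobs I) & (k <= j)%N] =
    [seq observe now (nth_job k) | k <- iota 0 j.+1].
  rewrite -(@filter_iota_leq (njobs I) 0 j) // -val_enum_ord filter_map -map_comp.
  by apply: eq_map => k' /=; rewrite nth_jobE.
by rewrite (nth_map 0%N) ?size_iota // nth_iota.
Qed.

Lemma size_observed (now : nat) (j : 'I_(njobs I)) :
  size [seq observe now (jobs I k)
       | k : 'I_(njobs I) <- enum 'I_(njobs I) & (k <= j)%N] = j.+1.
Proof.
rewrite size_map -(size_map val) -[map val _](filter_map val (fun k => k <= j)%N).
by rewrite val_enum_ord (@filter_iota_leq (njobs I) 0 j) // size_iota.
Qed.

(** Earlier decisions are recomputed from later observations, but the level of item [k] only uses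
    times elapsed at the arrival of [k], which later observations still determine. *)
Lemma run_balance (i0 : 'I_m) (p : R) (j : 'I_(njobs I)) : valid_instance I ->
  run (balance i0 p) j = assign i0 p (2 ^ clog p) (job_item nth_job) j.
Proof.
case=> _ mono _ _ _; rewrite /run /balance size_observed /=.
apply: eq_assign => k kj; rewrite /obs_item /job_item nth_observe //=.
have lev_eq : \max_(l < k.+1)
    clog ((obs_elapsed (nth obs0 [seq observe (arrival (jobs I j)) (jobs I k')
      | k' : 'I_(njobs I) <- enum 'I_(njobs I) & (k' <= j)%N] l)
      (arrival (nth_job k)))%:R
    / obs_estimate (nth obs0 [seq observe (arrival (jobs I j)) (jobs I k')
      | k' : 'I_(njobs I) <- enum 'I_(njobs I) & (k' <= j)%N] l)) =
  \max_(l < k.+1)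
    clog ((minn (duration (nth_job l))
      ((arrival (nth_job k)).+1 - arrival (nth_job l)))%:R
          / estimate (nth_job l)).
  apply: eq_bigr => l _; rewrite nth_observe; last first.
    by apply: leq_trans kj; rewrite -ltnS.
  rewrite obs_elapsed_observe //.
  have kn : (k < njobs I)%N by apply: leq_ltn_trans kj _.
  by rewrite -[k]/(val (Ordinal kn)) nth_jobE; apply: mono.
by rewrite lev_eq.
Qed.

End OnlineView.

(** * Norms of extended real vectors *)

Section ExtendedNorms.
Variables (R : realType) (m : nat) (p : R).
Hypothesis p1 : 1 <= p.

Let p0 : 0 < p.
Proof. by rewrite (lt_le_trans ltr01). Qed.

Lemma lp_normE (x : 'I_m -> \bar R) (y : 'I_m -> R) :
  (forall i, x i = (y i)%:E) -> lp_norm p x = (pnorm p y)%:E.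
Proof.
move=> xy; rewrite /lp_norm pnormE -poweR_EFin -sumEFin; congr (_ `^ _)%E.
by apply: eq_bigr => i _; rewrite xy poweR_EFin.
Qed.

Lemma lp_norm_ge0 (x : 'I_m -> \bar R) : (0 <= lp_norm p x)%E.
Proof. exact: poweR_ge0. Qed.

Lemma lp_norm_coord (x : 'I_m -> \bar R) i : (0 <= x i)%E ->
  (x i <= lp_norm p x)%E.
Proof.
move=> x0; have -> : x i = ((x i `^ p) `^ p^-1)%E.
  by rewrite -poweRrM mulfV ?gt_eqF // poweRe1.
have s0 : (0 <= \sum_(j < m) x j `^ p)%E.
  by apply: sume_ge0 => j _; exact: poweR_ge0.
apply: gt0_ler_poweR; rewrite ?invr_ge0 ?(ltW p0) //.
- by rewrite in_itv /= poweR_ge0 leey.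
- by rewrite in_itv /= s0 leey.
- rewrite (bigD1 i) //= leeDl //; apply: sume_ge0 => j _; exact: poweR_ge0.
Qed.

Lemma linf_norm_le_lp (x : 'I_m -> \bar R) : (forall i, 0 <= x i)%E ->
  (linf_norm x <= lp_norm p x)%E.
Proof.
move=> x0; apply: bigmax_le => [|i _]; first exact: lp_norm_ge0.
exact: lp_norm_coord.
Qed.

(** If [M] is the maximum, the sum of the powers is at most [m * M ^ p], and [m] is at most the
    [p]-th power of [expR 1]. *)
Lemma lp_norm_le_linf (x : 'I_m -> \bar R) : (0 < m)%N -> ln m%:R <= p ->
  (forall i, 0 <= x i)%E -> (lp_norm p x <= (expR 1)%:E * linf_norm x)%E.
Proof.
move=> m0 mp x0.
have mR : 0 < m%:R :> R by rewrite ltr0n.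
have xle i : (x i <= linf_norm x)%E.
  by rewrite /linf_norm; exact: (le_bigmax _ (fun i => x i)).
have : (0 <= linf_norm x)%E by exact: bigmax_ge_id.
case: (linf_norm x) xle => [M| |] // xle M0; last first.
  by rewrite gt0_muley ?lte_fin ?expR_gt0 // leey.
rewrite lee_fin in M0.
have xE i : x i = (fine (x i))%:E.
  by rewrite fineK // ge0_fin_numE // (le_lt_trans (xle i)) // ltry.
rewrite (lp_normE xE) -EFinM lee_fin.
apply/pnorm_leP => //; first by rewrite mulr_ge0 // expR_ge0.
apply: (@le_trans _ _ (\sum_(i < m) M `^ p)).
  apply: ler_sum => i _; apply: ler_powR2; [exact: ltW|exact: fine_ge0|].
  by rewrite -lee_fin -xE.
rewrite sumr_const card_ord powRM ?expR_ge0 // -[leLHS]mulr_natl.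
apply: ler_wpM2r; first exact: powR_ge0.
by rewrite /powR gt_eqF ?expR_gt0 // expRK mulr1 -ler_ln ?posrE ?expR_gt0 // expRK.
Qed.

End ExtendedNorms.

(** * Transfer of the schedule bound to instances *)

Section Bridge.
Variables (R : realType) (m : nat) (i0 : 'I_m) (I : instance R m).
Hypothesis valid : valid_instance I.

Local Notation n := (njobs I).
Local Notation J := (nth_job I).

Definition ext (f : 'I_n -> 'I_m) (k : nat) : 'I_m :=
  if insub k is Some j then f j else i0.

Lemma extE (f : 'I_n -> 'I_m) (j : 'I_n) : ext f j = f j.
Proof. by rewrite /ext valK. Qed.

Lemma machine_load_ge0 (f : 'I_n -> 'I_m) t i : (0 <= machine_load f t i)%E.
Proof. by case: valid => _ _ _ _ l0; apply: sume_ge0. Qed.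

Lemma machine_loadE (f : 'I_n -> 'I_m) (g : nat -> 'I_m) t i :
  (forall j : 'I_n, g j = f j) ->
  (forall j, load (jobs I j) (f j) < +oo)%E ->
  machine_load f t i =
  (true_load n (job_item J) (fun k => duration (J k)) g t i)%:E.
Proof.
move=> gf fin; case: valid => _ _ _ _ l0.
rewrite /machine_load /true_load -sumEFin big_mkord.
apply: eq_big => [j|j /andP[/eqP <- _]].
  by rewrite gf /in_slots /= nth_jobE andbC /alive.
by rewrite /iweight /= nth_jobE fineK // ge0_fin_numE.
Qed.

Lemma true_load_idle (g : nat -> 'I_m) t i :
  ~~ (1 <= t < horizon I + max_duration I)%N ->
  true_load n (job_item J) (fun k => duration (J k)) g t i = 0.
Proof.
move=> out; rewrite /true_load big_mkord big1 // => j /andP[/andP[/=]].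
rewrite nth_jobE; case: valid => /(_ j) h1 _ /(_ j) h2 _ _ h3 h4.
by exfalso; move/negP: out; apply; lia.
Qed.

Lemma objective_ge (norm : ('I_m -> \bar R) -> \bar R) (f : 'I_n -> 'I_m) t :
  (1 <= t < horizon I + max_duration I)%N ->
  (norm (machine_load f t) <= objective norm f)%E.
Proof.
move=> ht; rewrite /objective.
by apply: (le_bigmax_seq _ _ _ (fun t => norm (machine_load f t)));
  rewrite ?mem_index_iota.
Qed.

Lemma objective_le (norm : ('I_m -> \bar R) -> \bar R) (f : 'I_n -> 'I_m)
    (c : \bar R) :
  (0 <= c)%E ->
  (forall t, (1 <= t < horizon I + max_duration I)%N ->
    (norm (machine_load f t) <= c)%E) ->
  (objective norm f <= c)%E.
Proof.
move=> c0 H; rewrite /objective big_nat_cond; apply: bigmax_le => // t.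
by rewrite andbT; exact: H.
Qed.

Lemma objective_ge0 (norm : ('I_m -> \bar R) -> \bar R) (f : 'I_n -> 'I_m) :
  (0 <= objective norm f)%E.
Proof. exact: bigmax_ge_id. Qed.

(** Every job is alive in the slot after its arrival, where its load is at most the norm. *)
Lemma finite_objective (p : R) (f : 'I_n -> 'I_m) : 1 <= p ->
  (objective (lp_norm p) f < +oo)%E ->
  forall j, (load (jobs I j) (f j) < +oo)%E.
Proof.
move=> p1 fin j; apply: le_lt_trans fin.
case: valid => /(_ j) h1 _ /(_ j) h2 _ l0.
have ht : (1 <= (arrival (jobs I j)).+1 < horizon I + max_duration I)%N by lia.
apply: le_trans (objective_ge _ _ ht).
apply: (@le_trans _ _ (machine_load f (arrival (jobs I j)).+1 (f j))).
  rewrite /machine_load (bigD1 j) /=; last by rewrite eqxx /alive; lia.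
  by rewrite leeDl // sume_ge0.
by apply: lp_norm_coord => //; exact: machine_load_ge0.
Qed.

Variables (p mu1 mu2 : R).
Hypothesis p1 : 1 <= p.
Hypothesis dist : distortion_bounds I mu1 mu2.

Local Notation alg := (balance i0 p).
Local Notation c := (20 ^+ 3 * (mu1 * mu2 * (p + ln (mu1 * mu2 * max_estimate I)))).

Let max_estimate_ge1 : 1 <= max_estimate I.
Proof. exact: bigmax_ge_id. Qed.

Let mu1_ge1 : 1 <= mu1. Proof. by case: dist. Qed.
Let mu2_ge1 : 1 <= mu2. Proof. by case: dist. Qed.

Lemma ratio_gt0 : 0 < c.
Proof.
have y1 : 1 <= mu1 * mu2 * max_estimate I by rewrite !mulr_ege1.
have := ln_ge0 y1; have := p1.
move: (ln _) => l lp l0.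
by rewrite !mulr_gt0 ?(lt_le_trans ltr01) //; lra.
Qed.

Let est_ge1 k : 1 <= estimate (J k).
Proof. by rewrite /nth_job; case: insubP => //= j _ _; case: valid. Qed.

Let est_le k : estimate (J k) <= max_estimate I.
Proof.
rewrite /nth_job; case: insubP => //= j _ _.
exact: (le_bigmax _ (fun j => estimate (jobs I j))).
Qed.

Let dur_bounds k : (k < n)%N ->
  estimate (J k) <= mu2 * (duration (J k))%:R /\
  (duration (J k))%:R <= mu1 * estimate (J k).
Proof.
move=> kn; rewrite -[k]/(val (Ordinal kn)) nth_jobE.
case: dist => _ _ /(_ (Ordinal kn)) /= /andP[h1 h2].
have m20 : 0 < mu2 by rewrite (lt_le_trans ltr01).
split.
  by move: h1; rewrite ceil_le_int -pmulrn ler_pdivrMr // mulrC.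
by move: h2; rewrite floor_ge_int -pmulrn.
Qed.

Let level_exp k : ((2 ^ iexp (job_item J k))%N%:R : R) =
  2 ^+ ilevel (job_item J k) * 2 ^+ clog (estimate (J k)).
Proof. by rewrite natrX exprD. Qed.

Lemma balance_load_le (f : 'I_n -> 'I_m) (V : R) :
  objective (lp_norm p) f = V%:E ->
  forall t, (lp_norm p (machine_load (run alg (I := I)) t) <= (c * V)%:E)%E.
Proof.
move=> fV t.
have V0 : 0 <= V by rewrite -lee_fin -fV objective_ge0.
have fin := finite_objective p1 (f := f); rewrite fV ltry in fin.
have {}fin := fin isT.
have P0 : (0 < 2 ^ clog p)%N by rewrite expn_gt0.
have pP : p <= (2 ^ clog p)%N%:R by rewrite natrX clog_ge // (le_trans ler01).
pose a := assign i0 p (2 ^ clog p) (job_item J).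
have rE (j : 'I_n) : a j = run alg j by rewrite run_balance.
have afin j : (load (jobs I j) (run alg j) < +oo)%E.
  have := @assign_finite _ _ i0 p (2 ^ clog p) (job_item J) j (f j).
  by rewrite -/(a j) rE /finite_on /= nth_jobE; apply.
rewrite (lp_normE p (fun i => machine_loadE t i rE afin)) lee_fin.
(* Witnessed ratios never exceed [mu1], which bounds the levels; virtual exponents add at most the
   logarithm of the largest estimate, which bounds the classes. *)
pose K := clog mu1.
pose C := up_log 2 ((clog mu1 + clog (max_estimate I)) %/ 2 ^ clog p).+1.
have lev_le k : (k < n)%N -> (ilevel (job_item J k) <= K)%N.
  move=> kn; apply/bigmax_leqP => l _; apply: le_clog.
    by rewrite divr_ge0 // (le_trans ler01).
  have e0 : 0 < estimate (J l) by rewrite (lt_le_trans ltr01).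
  rewrite ler_pdivrMr //.
  have [|_ H] := @dur_bounds l; first by apply: leq_ltn_trans kn; rewrite -ltnS.
  by apply: le_trans H; rewrite ler_nat geq_minl.
apply: (le_trans (@schedule_load_le R m i0 p (2 ^ clog p) n (job_item J)
  (fun k => duration (J k)) (ext f) mu2 V K C p1 pP _ _ _ mu2_ge1 _ _ lev_le
  _ _ V0 _ t)).
- move=> k i /=; rewrite /nth_job; case: insubP => //= j _ _.
  by case: valid => _ _ _ _; apply.
- move=> k j kj jn /=; have kn := leq_ltn_trans kj jn.
  rewrite -[k]/(val (Ordinal kn)) -[j]/(val (Ordinal jn)) !nth_jobE.
  by case: valid => _ + _ _ _; apply.
- move=> j jn; rewrite -[j]/(val (Ordinal jn)) nth_jobE.
  by case: valid => _ _ /(_ (Ordinal jn)) /andP[].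
- move=> j jn; rewrite level_exp -[leRHS]mulrA; apply: ler_wpM2l.
    by rewrite exprn_ge0.
  apply: (le_trans (clog_le (est_ge1 j))); rewrite -mulrA ler_pM2l //.
  by case: (dur_bounds jn).
(* As [k] is alive right after the arrival of [j], its elapsed time enters the level of [j]
   uncapped. That level is also the level of [k], so the virtual duration covers the elapsed
   time. *)
- move=> k j kj jn lev_eq /= h.
  have sE : minn (duration (J k)) ((arrival (J j)).+1 - arrival (J k)) =
      ((arrival (J j)).+1 - arrival (J k))%N by apply/minn_idPr; lia.
  have e0 : 0 < estimate (J k) by rewrite (lt_le_trans ltr01).
  have H : ((arrival (J j)).+1 - arrival (J k) <= 2 ^ iexp (job_item J k))%N.
    rewrite -(ler_nat R) level_exp lev_eq.
    set s := ((arrival (J j)).+1 - arrival (J k))%N.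
    have s0 : 0 <= s%:R / estimate (J k) by rewrite divr_ge0 // ltW.
    have lvl : (clog (s%:R / estimate (J k)) <= ilevel (job_item J j))%N.
      have kj' : (k < j.+1)%N by [].
      rewrite /s -sE.
      exact: (@leq_bigmax _ (fun k : 'I_j.+1 => clog ((minn (duration (J k))
        ((arrival (J j)).+1 - arrival (J k)))%:R / estimate (J k)))
        (Ordinal kj')).
    have h1 : s%:R <= 2 ^+ ilevel (job_item J j) * estimate (J k).
      rewrite -ler_pdivrMr //; apply: (le_trans (clog_ge s0)).
      by rewrite ler_eXn2l // ltr1n.
    apply: (le_trans h1); apply: ler_wpM2l; first by rewrite exprn_ge0.
    by rewrite clog_ge // ltW.
  by move: H => /=; lia.
- move=> k kn; apply: leq_up_log; rewrite ltnS; apply: leq_div2r.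
  apply: leq_add; first exact: lev_le.
  by apply: le_clog; [rewrite (le_trans ler01)|exact: est_le].
- move=> k kn; rewrite /finite_on /= -[k]/(val (Ordinal kn)) nth_jobE extE.
  exact: fin.
(* The objective controls only its own range of slots; elsewhere the true load vanishes. *)
- move=> t'; have [ht|out] := boolP (1 <= t' < horizon I + max_duration I)%N.
    rewrite -lee_fin -(lp_normE p (fun i => machine_loadE t' i (extE f) fin)).
    by rewrite -fV objective_ge.
  have -> : true_load n (job_item J) (fun k => duration (J k)) (ext f) t' =
      (fun=> 0) by apply/funext => i; exact: true_load_idle.
  by rewrite pnorm0.
- apply: (le_trans (sum_levels_le _ _ P0 _ V0)); first by rewrite (le_trans ler01).
  exact: ratio_le.
Qed.

(** The bound is shown against each offline assignment and passes to the minimum; infinite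
    objectives are trivial because the ratio is positive. *)
Lemma balance_objective_le :
  (objective (lp_norm p) (run alg (I := I)) <= c%:E * opt (lp_norm p) I)%E.
Proof.
have c0 := ratio_gt0; rewrite /opt.
apply: (big_ind (fun x => objective (lp_norm p) (run alg (I := I)) <= c%:E * x)%E).
- by rewrite gt0_muley ?lte_fin // leey.
- by move=> x y hx hy; rewrite /Order.min; case: ifP.
- move=> f _; have := objective_ge0 (lp_norm p) f.
  case fV : (objective (lp_norm p) f) => [V| |] // V0; last first.
    by rewrite gt0_muley ?lte_fin // leey.
  rewrite -EFinM; apply: objective_le; last first.
    by move=> t _; exact: balance_load_le fV t.
  by rewrite lee_fin; apply: mulr_ge0; [exact: ltW|rewrite -lee_fin].
Qed.

End Bridge.

(** * Comparison of optima and the two competitive ratios *)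

Lemma le_opt_mul (R : realType) (m : nat) (norm norm' : ('I_m -> \bar R) -> \bar R)
    (I : instance R m) (e : R) : 0 < e ->
  (forall f : 'I_(njobs I) -> 'I_m,
    objective norm f <= e%:E * objective norm' f)%E ->
  (opt norm I <= e%:E * opt norm' I)%E.
Proof.
move=> e0 H; rewrite {2}/opt.
apply: (big_ind (fun x => opt norm I <= e%:E * x)%E).
- by rewrite gt0_muley ?lte_fin // leey.
- by move=> x y hx hy; rewrite /Order.min; case: ifP.
- move=> f _; apply: le_trans (H f); rewrite /opt.
  exact: (bigmin_le _ f (fun f : {ffun 'I_(njobs I) -> 'I_m} => objective norm f)).
Qed.

Theorem theorem1 (R : realType) :
  (exists2 C : R, 0 < C &
    forall (p : R) (m : nat), 1 <= p -> (0 < m)%N ->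
      exists alg : online_algorithm R m,
        competitive (lp_norm p) alg
          (fun mu Dt => C * (mu * (p + ln (mu * Dt))))) /\
  (exists2 C : R, 0 < C &
    forall m : nat, (0 < m)%N ->
      exists alg : online_algorithm R m,
        competitive (@linf_norm R m) alg
          (fun mu Dt => C * (mu * Num.max 1 (ln (m%:R * mu * Dt))))).
Proof.
split.
  exists (20 ^+ 3); first by rewrite exprn_gt0.
  move=> p m p1 m0; exists (balance (Ordinal m0) p) => I mu1 mu2 vI dI.
  exact: balance_objective_le.
(* The factor [expR 1] is the loss between the two norms, and [2] comes from
   [p + ln (mu * D) <= 2 * M]. *)
exists (20 ^+ 3 * 2 * expR 1); first by rewrite !mulr_gt0 ?expR_gt0 // exprn_gt0.
(* With [p] at least [ln m], the two norms agree up to the factor [expR 1]. *)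
move=> m m0; pose p : R := Num.max 1 (ln m%:R).
have p1 : 1 <= p by rewrite le_max lexx.
have mp : ln m%:R <= p by rewrite le_max lexx orbT.
exists (balance (Ordinal m0) p) => I mu1 mu2 vI dI.
have e0 : 0 < expR 1 :> R by exact: expR_gt0.
set D := max_estimate I.
have D1 : 1 <= D by exact: bigmax_ge_id.
have [m1 m2 _] := dI.
set mu := mu1 * mu2.
have mu_ge1 : 1 <= mu by exact: mulr_ege1.
set M := Num.max 1 _.
have mR : 1 <= m%:R :> R by rewrite ler1n.
have y1 : 1 <= mu * D by exact: mulr_ege1.
have y0 : 0 < mu * D by exact: lt_le_trans y1.
have l0 : 0 <= ln (mu * D) by exact: ln_ge0.
have lM : ln m%:R + ln (mu * D) <= M.
  by rewrite -lnM ?posrE ?ltr0n // mulrA le_max lexx orbT.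
have lm0 : 0 <= ln (m%:R : R) by exact: ln_ge0.
have M1 : 1 <= M by rewrite le_max lexx.
have pM : p + ln (mu * D) <= 2 * M.
  have : p <= M by rewrite /p ge_max M1 /=; apply: le_trans lM; rewrite lerDl.
  lra.
have opt0 : (0 <= opt (@linf_norm R m) I)%E.
  by rewrite /opt; apply: le_bigmin => [|f _]; [exact: leey|exact: objective_ge0].
pose c := 20 ^+ 3 * (mu * (p + ln (mu * D))).
have c0 : 0 < c by exact: (ratio_gt0 p1 dI).
apply: (@le_trans _ _ (c%:E * ((expR 1)%:E * opt (@linf_norm R m) I))%E).
  apply: (@le_trans _ _ (c%:E * opt (lp_norm p) I)%E).
    apply: (@le_trans _ _
      (objective (lp_norm p) (run (balance (Ordinal m0) p) (I := I)))).
      apply: objective_le; first exact: objective_ge0.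
      move=> t ht; apply: le_trans (objective_ge _ _ ht).
      by apply: linf_norm_le_lp => // i; exact: machine_load_ge0.
    exact: balance_objective_le.
  apply: lee_wpmul2l; first by rewrite lee_fin ltW.
  apply: le_opt_mul => // f; apply: objective_le.
    by apply: mule_ge0; [rewrite lee_fin ltW|exact: objective_ge0].
  move=> t ht; apply: (le_trans (lp_norm_le_linf p1 m0 mp _)).
    by move=> i; exact: machine_load_ge0.
  apply: lee_wpmul2l; first by rewrite lee_fin ltW.
  exact: objective_ge.
rewrite muleA -EFinM; apply: lee_wpmul2r => //; rewrite lee_fin.
have -> : 20 ^+ 3 * 2 * expR 1 * (mu * M) = 20 ^+ 3 * (mu * (2 * M)) * expR 1.
  by ring.
apply: ler_wpM2r; first exact: ltW.
apply: ler_wpM2l; first by rewrite exprn_ge0.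
by apply: ler_wpM2l => //; exact: le_trans mu_ge1.
Qed.
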